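(* Let $A\in\mathcal D$ with generic part $A_0$, and let $(P_0,Q_0),(P_0',Q_0')\in\mathcal D_{A_0}$. Then, for the usual order of selfadjoint operators, $P_0+Q_0\le P_0'+Q_0'$ if and only if $P_0=P_0'$ and $Q_0=Q_0'$.
   Context: Let $\mathcal H$ be a complex Hilbert space, $\mathcal P(\mathcal H)$ the set of orthogonal projections in $\mathcal H$, and $\mathcal D=\{P-Q: P,Q\in\mathcal P(\mathcal H)\}$. For $A\in\mathcal D$ put $\mathcal H_0=(N(A)\oplus N(A^2-1))^\perp$ ($N$ denotes nullspace); this subspace reduces $A$. Let $A_0=A|_{\mathcal H_0}\in\mathcal B(\mathcal H_0)$ (the generic part of $A$) and $\mathcal D_{A_0}=\{(P_0,Q_0)\in\mathcal P(\mathcal H_0)\times\mathcal P(\mathcal H_0): P_0-Q_0=A_0\}$. *)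

(* Defs.v *)
From HB Require Import structures.
From mathcomp Require Import all_boot all_order all_algebra.
From mathcomp Require Import sesquilinear complex.
From mathcomp Require Import boolp classical_sets functions reals.
From mathcomp Require Import topology normedtype.

Set Implicit Arguments.
Unset Strict Implicit.
Unset Printing Implicit Defensive.

Import Order.TTheory GRing.Theory Num.Theory.
Import numFieldNormedType.Exports.

Local Open Scope classical_set_scope.
Local Open Scope complex_scope.
Local Open Scope ring_scope.

(* Positive definiteness of [inner] is not a separate axiom: it follows from
   [inner_normE] (see [inner_gt0]). *)
HB.mixin Record CompleteNormedModule_isHilbert (R : realType) H
    & CompleteNormedModule R[i] H := {
  inner : H -> H -> R[i];
  inner_linearl : forall (a : R[i]) (x y z : H),
    inner (a *: x + y) z = a * inner x z + inner y z;
  inner_conj : forall x y : H, inner x y = Num.conj (inner y x);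
  inner_normE : forall x : H, `|x| ^+ 2 = inner x x }.

#[short(type="hilbertType")]
HB.structure Definition Hilbert (R : realType) :=
  {H of CompleteNormedModule R[i] H & CompleteNormedModule_isHilbert R H}.

Section InnerProduct.
Context {R : realType} {H : hilbertType R}.

Lemma inner_linear (z : H) :
  GRing.linear_for *%R (inner^~ z : H -> R[i]).
Proof. by move=> a x y; exact: inner_linearl. Qed.

Lemma inner_sesqui (z : H) :
  GRing.linear_for (Num.conj \; *%R) (inner z : H -> R[i]).
Proof.
by move=> a x y; rewrite inner_conj inner_linearl rmorphD rmorphM/= -!inner_conj.
Qed.

HB.instance Definition _ := bilinear_isBilinear.Build R[i] H H R[i]
  *%R (Num.conj \; *%R) (inner : H -> H -> R[i])
  (conj inner_linear inner_sesqui).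

Lemma inner_herm (x y : H) :
  inner x y = (-1) ^+ false * Num.conj (inner y x).
Proof. by rewrite expr0 mul1r; exact: inner_conj. Qed.

HB.instance Definition _ := isHermitianSesquilinear.Build R[i] H false
  Num.conj (inner : H -> H -> R[i]) inner_herm.

Lemma inner_gt0 (x : H) : x != 0 -> 0 < inner x x.
Proof. by move=> x0; rewrite -inner_normE exprn_gt0// normr_gt0. Qed.

HB.instance Definition _ := isDotProduct.Build R[i] H
  (inner : H -> H -> R[i]) inner_gt0.


Lemma innerBl (x y z : H) : inner (x - y) z = inner x z - inner y z.
Proof. by rewrite addrC -scaleN1r inner_linearl mulN1r addrC. Qed.

Lemma inner0l (z : H) : inner (0 : H) z = 0.
Proof. by rewrite -(subrr (0 : H)) innerBl subrr. Qed.

Lemma innerBr (x y z : H) : inner z (x - y) = inner z x - inner z y.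
Proof. by rewrite inner_conj innerBl rmorphB/= -!inner_conj. Qed.

Lemma inner0r (z : H) : inner z (0 : H) = 0.
Proof. by rewrite inner_conj inner0l rmorph0. Qed.

Lemma inner_cauchy_schwarz (x y : H) : `|inner x y| <= `|x| * `|y|.
Proof.
have [->|y0] := eqVneq y 0; first by rewrite inner0r !normr0 mulr0.
have ny : 0 < `|y| by rewrite normr_gt0.
have ny2 : 0 < `|y| ^+ 2 by rewrite exprn_gt0.
rewrite -ler_sqr ?nnegrE ?mulr_ge0// exprMn.
have ry : Num.conj (`|y| ^+ 2 : R[i]) = `|y| ^+ 2.
  by rewrite rmorphXn/= conj_Creal// normr_real.
pose a := inner x y; pose u : H := `|y| ^+ 2 *: x - a *: y.
have : 0 <= inner u u by rewrite -inner_normE exprn_ge0.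
have yy : inner y y = `|y| ^+ 2 by rewrite inner_normE.
have uE : u = (- a) *: y + (`|y| ^+ 2 *: x + 0).
  by rewrite addr0 scaleNr addrC.
have uy : inner u y = 0.
  by rewrite uE !inner_linearl inner0l addr0 yy -/a mulNr mulrC addNr.
have -> : inner u u = `|y| ^+ 2 * inner u x.
  by rewrite {2}uE !inner_sesqui/= inner0r addr0 uy mulr0 add0r ry.
rewrite pmulr_rge0// uE !inner_linearl inner0l addr0.
by rewrite -inner_normE inner_conj -/a mulNr -normCK addrC subr_ge0 mulrC.
Qed.

End InnerProduct.

Record closed_subspace (R : realType) (H : hilbertType R) := ClosedSubspace {
  cs_set :> set H ;
  cs_submod : GRing.submod_closed (fun x : H => x \in cs_set) ;
  cs_closed : closed cs_set }.

(* The subspace as a type, made a Hilbert space with the restricted inner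
   product. *)
Section SubHilbert.
Context {R : realType} {H : hilbertType R}.
Variable S : closed_subspace H.

Record subHilbert := SubHilbert { hval : H ; hvalP : hval \in (S : set H) }.

HB.instance Definition _ := [isSub for hval].
HB.instance Definition _ := [Choice of subHilbert by <:].
HB.instance Definition _ := GRing.SubChoice_isSubLmodule.Build R[i] H
  (fun x : H => x \in (S : set H)) subHilbert
  (GRing.submod_closed_semi (@cs_submod R H S)).

Definition sub_norm (x : subHilbert) : R[i] := `|hval x|.

Lemma sub_normD x y : sub_norm (x + y) <= sub_norm x + sub_norm y.
Proof. by rewrite /sub_norm; exact: ler_normD. Qed.

Lemma sub_normZ (a : R[i]) x : sub_norm (a *: x) = `|a| * sub_norm x.
Proof. by rewrite /sub_norm; exact: normrZ. Qed.

Lemma sub_norm0_eq0 x : sub_norm x = 0 -> x = 0.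
Proof. by move=> /normr0_eq0 x0; apply: val_inj. Qed.

HB.instance Definition _ := Lmodule_isNormed.Build R[i] subHilbert
  sub_normD sub_normZ sub_norm0_eq0.

Lemma sub_complete (F : set_system subHilbert) :
  ProperFilter F -> cauchy F -> cvg F.
Proof.
move=> FF /cauchy_ballP Fc.
have GF : ProperFilter (hval @ F) by exact: fmap_proper_filter.
have Gc : cauchy (hval @ F).
  apply/cauchy_ballP => e e0; have := Fc e e0.
  by rewrite -!ball_normE => Fe; rewrite near_map2; exact: Fe.
have /cvg_ex[l Gl] : cvg (hval @ F) by exact: cauchy_cvg.
have Sl : (S : set H) l.
  apply: (@closed_cvg _ _ F FF hval (S : set H) (@cs_closed R H S) _ l Gl).
  by apply: nearW => x; apply/set_mem/hvalP.
apply/cvg_ex; exists (SubHilbert (mem_set Sl)).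
apply/cvgrPdist_lt => e e0.
by move/cvgrPdist_lt: Gl => /(_ e e0).
Qed.

HB.instance Definition _ := Uniform_isComplete.Build subHilbert sub_complete.

Definition sub_inner (x y : subHilbert) : R[i] := inner (hval x) (hval y).

Lemma sub_inner_linearl (a : R[i]) x y z :
  sub_inner (a *: x + y) z = a * sub_inner x z + sub_inner y z.
Proof. exact: inner_linearl. Qed.

Lemma sub_inner_conj x y : sub_inner x y = Num.conj (sub_inner y x).
Proof. exact: inner_conj. Qed.

Lemma sub_inner_normE (x : subHilbert) : `|x| ^+ 2 = sub_inner x x.
Proof. exact: inner_normE. Qed.

HB.instance Definition _ := CompleteNormedModule_isHilbert.Build R subHilbert
  sub_inner_linearl sub_inner_conj sub_inner_normE.

Definition restrict (T : H -> H) (TS : forall x, cs_set S x -> cs_set S (T x))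
    (x : subHilbert) : subHilbert :=
  SubHilbert (mem_set (TS _ (set_mem (hvalP x)))).

End SubHilbert.

Section Operators.
Context {R : realType} {H : hilbertType R}.
Implicit Types (P Q S T : H -> H).

Definition bounded_operator : set (H -> H) :=
  [set T | linear T /\ continuous T].

Definition selfadjoint : set (H -> H) :=
  [set T | forall x y, inner (T x) y = inner x (T y)].

Definition projection : set (H -> H) :=
  [set P | [/\ bounded_operator P, P \o P = P & selfadjoint P]].

(* [<=] on R[i] forces equal imaginary parts; both sides are real when S and T
   are selfadjoint. *)
Definition op_le S T := forall x, inner (S x) x <= inner (T x) x.

Definition diff_projections : set (H -> H) :=
  [set A | exists P Q, [/\ projection P, projection Q & A = P - Q]].

Definition diff_pairs (A : H -> H) : set ((H -> H) * (H -> H)) :=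
  [set PQ | [/\ projection PQ.1, projection PQ.2 & PQ.1 - PQ.2 = A]].

Definition nullspace T : set H := [set x | T x = 0].

Definition orthogonal_set (X : set H) : set H :=
  [set x | forall y, X y -> inner x y = 0].

Lemma orthogonal_submod X :
  GRing.submod_closed (fun x : H => x \in orthogonal_set X).
Proof.
split=> [|a x y /set_mem Xx /set_mem Xy]; apply/mem_set => z Xz.
  exact: inner0l.
by rewrite inner_linearl Xx// Xy// mulr0 addr0.
Qed.

Lemma orthogonal_closed X : closed (orthogonal_set X).
Proof.
move=> x clx y Xy; apply/eqP; rewrite -normr_eq0; apply/contraT => nz.
have y0 : 0 < `|y|.
  by rewrite normr_gt0; apply: contra_neq nz => ->; rewrite inner0r normr0.
have e0 : 0 < `|inner x y| / `|y| by rewrite divr_gt0// lt_neqAle eq_sym nz/=.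
have [z [Xz]] := clx _ (nbhsx_ballx x _ e0).
rewrite -ball_normE/= ltr_pdivlMr// => /le_lt_trans-/(_ _
  (inner_cauchy_schwarz (x - z) y)).
by rewrite innerBl (Xz y Xy) subr0 ltxx.
Qed.

Definition orthocomp (X : set H) : closed_subspace H :=
  ClosedSubspace (orthogonal_submod X) (@orthogonal_closed X).

Definition sum_set (X Y : set H) : set H := [set x + y | x in X & y in Y].

(* For selfadjoint A, N(A) and N(A^2 - 1) are orthogonal, so [sum_set] is their
   orthogonal direct sum. *)
Definition generic_space (A : H -> H) : closed_subspace H :=
  orthocomp (sum_set (nullspace A) (nullspace (A \o A - idfun))).

Lemma diff_projections_selfadjoint A : diff_projections A -> selfadjoint A.
Proof.
move=> [P [Q [[_ _ sP] [_ _ sQ] ->]]] x y.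
have -> : (P - Q) x = P x - Q x by [].
have -> : (P - Q) y = P y - Q y by [].
by rewrite innerBl innerBr sP sQ.
Qed.

Lemma diff_projectionsD A : diff_projections A -> {morph A : x y / x + y}.
Proof.
move=> [P [Q [[[lP _] _ _] [[lQ _] _ _] ->]]] x y.
have PD : P (x + y) = P x + P y by have := lP 1 x y; rewrite !scale1r.
have QD : Q (x + y) = Q x + Q y by have := lQ 1 x y; rewrite !scale1r.
have E z : (P - Q) z = P z - Q z by [].
by rewrite !E PD QD opprD addrACA.
Qed.

Lemma diff_projections0 A : diff_projections A -> A 0 = 0.
Proof.
move=> DA; apply: (@addIr _ (A 0)).
by rewrite -(diff_projectionsD DA) addr0 add0r.
Qed.

Lemma generic_space_invariant A : diff_projections A ->
  forall x,
    cs_set (generic_space A) x -> cs_set (generic_space A) (A x).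
Proof.
move=> DA x Gx _ [y Ay [z A2z <-]].
rewrite (diff_projections_selfadjoint DA) (diff_projectionsD DA) Ay add0r.
have AAz : A (A z) = z by apply/subr0_eq; exact: A2z.
apply: Gx; exists 0; last exists (A z); rewrite ?add0r//.
  by rewrite /nullspace/= (diff_projections0 DA).
by rewrite /nullspace/=; apply/eqP; rewrite subr_eq0 /= AAz.
Qed.

Definition generic_part (A : H -> H) (DA : diff_projections A) :
    subHilbert (generic_space A) -> subHilbert (generic_space A) :=
  restrict (generic_space_invariant DA).

End Operators.

(* Main.v *)
Require Import Defs.
From mathcomp Require Import all_boot all_order all_algebra.
From mathcomp Require Import boolp classical_sets functions reals.
From mathcomp Require Import topology normedtype.
From mathcomp Require Import complex.
Local Open Scope classical_set_scope.
Local Open Scope ring_scope.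

(* If P - Q = P' - Q', then E := P' - P = Q' - Q and P + Q <= P' + Q' says
   2 E >= 0.  Hence P <= P' and Q <= Q', so P P' = P and Q Q' = Q, which gives
   P E = Q E = 0 and thus (P - Q) E = 0.  As the generic part is injective,
   E = 0. *)

Import Order.TTheory GRing.Theory Num.Theory.

Section Projections.
Context {R : realType} {H : hilbertType R}.
Implicit Types (P Q : H -> H) (x y z : H).

Lemma innerDl x y z : inner (x + y) z = inner x z + inner y z.
Proof. by rewrite -{1}(scale1r x) inner_linearl mul1r. Qed.

Lemma inner_eq0 x : inner x x = 0 -> x = 0.
Proof.
by rewrite -inner_normE => /eqP; rewrite expf_eq0/= normr_eq0 => /eqP.
Qed.

Lemma projectionB P x y : projection P -> P (x - y) = P x - P y.
Proof.
by move=> [[lP _] _ _]; rewrite -scaleN1r addrC lP scaleN1r addrC.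
Qed.

Lemma projectionK P x : projection P -> P (P x) = P x.
Proof. by move=> [_ PP _]; rewrite -{3}PP. Qed.

Lemma inner_projection P x : projection P -> inner (P x) x = inner (P x) (P x).
Proof. by move=> pP; have [_ _ sP] := pP; rewrite -sP projectionK. Qed.

(** For [y = P x] the order hypothesis at [y] reads [<y, y> <= <P' y, y>], while
    [|y - P' y|^2 = <y, y> - <P' y, y>], so this square is at most 0. *)
Lemma projection_le_compr P P' x :
  projection P -> projection P' -> op_le P P' -> P' (P x) = P x.
Proof.
move=> pP pP' /(_ (P x)); rewrite projectionK// => le.
apply/esym/subr0_eq/inner_eq0/le_anti/andP; split; last first.
  by rewrite -inner_normE exprn_ge0.
have [_ _ sP'] := pP'.
rewrite innerBl (innerBr _ _ (P' _)) -(inner_projection _ _ pP').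
by rewrite subrr subr0 innerBr -sP' subr_le0.
Qed.

(** Adjoint form of the previous lemma: for [d = P (P' x) - P x], selfadjointness turns [<d, d>]
    into [<x, P' (P d)> - <x, P d>], which is 0. *)
Lemma projection_le_compl P P' x :
  projection P -> projection P' -> op_le P P' -> P (P' x) = P x.
Proof.
move=> pP pP' le; have [_ _ sP] := pP; have [_ _ sP'] := pP'.
apply/subr0_eq/inner_eq0; set d := (X in inner X X).
by rewrite {1}/d innerBl !sP sP' projection_le_compr// subrr.
Qed.

(** Here [A] may have a kernel, so the argument stops short of [P' x = P x]; injectivity enters once
    [A] is taken to be a generic part. *)
Lemma diff_pairs_le_diff0 {P Q P' Q'} {A : H -> H} x :
  diff_pairs A (P, Q) -> diff_pairs A (P', Q') ->
  op_le (P + Q) (P' + Q') -> A (P' x - P x) = 0.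
Proof.
move=> [/= pP pQ <-] [/= pP' pQ' eA] le.
have E y : P' y - P y = Q' y - Q y.
  have := congr1 (fun f : H -> H => f y) eA.
  rewrite -[(P' - Q') y]/(P' y - Q' y) -[(P - Q) y]/(P y - Q y) => /eqP.
  by rewrite subr_eq => /eqP ->; rewrite addrAC (addrAC (P y)) subrr add0r addrC.
have E0 y : 0 <= inner (P' y - P y) y.
  (* By [E] the two sides of [le y] differ by twice [<P' y - P y, y>], and the factor 2 can be
     cancelled. *)
  have := le y; rewrite -[(P + Q) y]/(P y + Q y) -[(P' + Q') y]/(P' y + Q' y).
  rewrite -subr_ge0 -innerBl opprD addrACA -E.
  by set d := P' y - P y; rewrite innerDl -mulr2n pmulrn_lge0.
have leP : op_le P P' by move=> y; rewrite -subr_ge0 -innerBl.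
have leQ : op_le Q Q' by move=> y; rewrite -subr_ge0 -innerBl -E.
have PE : P (P' x - P x) = 0.
  by rewrite (projectionB _ _ _ pP) (projection_le_compl _ _ _ pP pP' leP)
     (projectionK _ _ pP) subrr.
have QE : Q (P' x - P x) = 0.
  by rewrite E (projectionB _ _ _ pQ) (projection_le_compl _ _ _ pQ pQ' leQ)
     (projectionK _ _ pQ) subrr.
by rewrite -[LHS]/(P (P' x - P x) - Q (P' x - P x)) PE QE subrr.
Qed.

(** A vector of the generic space killed by [A] lies in [N(A)], to which that space is orthogonal;
    so it is orthogonal to itself. *)
Lemma generic_part_inj0 {A : H -> H} (DA : diff_projections A)
    (x : subHilbert (generic_space A)) :
  generic_part DA x = 0 -> x = 0.
Proof.
move=> Ax0; have Ax : A (hval x) = 0 := congr1 (@hval _ _ _) Ax0.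
apply: val_inj; apply: inner_eq0; apply: (set_mem (hvalP x)).
(* [hval x] is seen in the sum of the two nullspaces as [hval x + 0], with 0 taken in
   [N(A^2 - 1)]. *)
exists (hval x) => //; exists 0; last exact: addr0.
by rewrite /nullspace/= -[LHS]/(A (A 0) - 0) !(diff_projections0 DA) subr0.
Qed.

End Projections.

Theorem mainTheorem12 (R : realType) (H : hilbertType R) (A : H -> H)
    (DA : diff_projections A)
    (P0 Q0 P0' Q0' :
       subHilbert (generic_space A) -> subHilbert (generic_space A))
    (hPQ : diff_pairs (generic_part DA) (P0, Q0))
    (hPQ' : diff_pairs (generic_part DA) (P0', Q0')) :
  op_le (P0 + Q0) (P0' + Q0') <-> P0 = P0' /\ Q0 = Q0'.
Proof.
split=> [le|[-> ->] x]; last exact: lexx.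
have PP : P0 = P0'.
  apply/funext => x; apply/esym/subr0_eq/(generic_part_inj0 DA).
  exact: diff_pairs_le_diff0 hPQ hPQ' le.
(* Both pairs have the same difference, so equal first members cancel. *)
split=> //; move: hPQ hPQ' => [/= _ _ <-] [/= _ _].
by rewrite PP => /addrI/oppr_inj.
Qed.
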